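(* For all integers $m,n\geq 1$ with $m+n\geq 5$, the arc complex $\mathcal{A}_{m,n}$ of the integral strip $P(m,n)$ is strongly collapsible.
   Context: Integral strip. For $m,n\ge1$, $P(m,n)$ is the quadrilateral with corners $(1,0),(1,1),(n,1),(m,0)$, whose vertices are the $m$ points $(1,0),(2,0),\dots,(m,0)$ on the $x$-axis (the $x$-vertices, coloured blue, the $i$-th one being $(i,0)$) and the $n$ points $(1,1),(2,1),\dots,(n,1)$ on the line $y=1$ (the $y$-vertices, coloured red, the $j$-th one being $(j,1)$). Topologically it is an $(m+n)$-gon, i.e. a closed disk with $m+n$ marked points on its boundary, coloured so that the $m$ blue vertices are consecutive and the $n$ red vertices are consecutive. The portions of the boundary between consecutive vertices are the edges. Arcs. A simple arc is an embedded arc in the disk whose endpoints are vertices and whose interior avoids the boundary; it is trivial if it is homotopic, relative to its endpoints, to a vertex or an edge. Non-trivial arcs, up to homotopy relative to endpoints, are exactly the diagonals of the $(m+n)$-gon. Two homotopy classes are disjoint if they have representatives that are disjoint (except possibly at endpoints). Arc complex. $\mathcal{A}_{m,n}$ is the simplicial complex whose 0-simplices are the homotopy classes of non-trivial arcs of $P(m,n)$ with one blue and one red endpoint, and whose $k$-simplices ($k\ge1$) are the sets of $k+1$ pairwise disjoint and distinct such homotopy classes. Strong collapse. A 0-simplex $v$ of a simplicial complex $X$ is vertex-dominated if there is another 0-simplex $v'$ such that the link of $v$ in $X$ is a join $v'*L$ for some subcomplex $L$ of $X$ (equivalently, every maximal simplex containing $v$ contains $v'$; $L$ may be the empty complex).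 In that case $X$ strongly collapses onto $X\smallsetminus\{v\}:=\{\eta\in X\mid v\notin\eta\}$. A finite complex is strongly collapsible if some finite sequence of strong collapses reduces it to a single 0-simplex. *)

(* Defs.v *)
From Stdlib Require Import Relation_Operators.
From mathcomp Require Import all_boot all_order all_algebra.
From mathcomp Require Import all_classical all_reals all_analysis.

Set Implicit Arguments.
Unset Strict Implicit.
Unset Printing Implicit Defensive.

Import Order.TTheory GRing.Theory Num.Theory.
Import numFieldNormedType.Exports.

Local Open Scope classical_set_scope.
Local Open Scope ring_scope.

(** Abstract simplicial complexes are sets of finite nonempty simplices, so
    that the empty complex is [set0]. *)

Definition simplicial_complex (T : Type) (X : set (set T)) : Prop :=
  (forall s, X s -> finite_set s /\ s !=set0) /\
  (forall s t, X s -> t `<=` s -> t !=set0 -> X t).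

Definition link (T : Type) (X : set (set T)) (v : T) : set (set T) :=
  [set s | [/\ X s, ~ s v & X (v |` s)]].

Definition deletion (T : Type) (X : set (set T)) (v : T) : set (set T) :=
  [set s | X s /\ ~ s v].

(** Since the empty set is not a simplex, the simplices coming from [K] alone
    and from [L] alone are listed separately. *)
Definition join (T : Type) (K L : set (set T)) : set (set T) :=
  K `|` L `|` [set s `|` t | s in K & t in L].

Definition vertex_dominated (T : Type) (X : set (set T)) (v : T) : Prop :=
  X [set v] /\
  exists v' L, [/\ v' <> v, X [set v'],
    simplicial_complex L /\ L `<=` X,
    (* the join is only formed between complexes without common vertex *)
    forall s, L s -> ~ s v' &
    link X v = join [set [set v']] L].

Definition strong_collapse (T : Type) (X Y : set (set T)) : Prop :=
  exists2 v, vertex_dominated X v & Y = deletion X v.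

Definition strongly_collapsible (T : Type) (X : set (set T)) : Prop :=
  [/\ simplicial_complex X, finite_set X &
      exists v : T, clos_refl_trans _ (@strong_collapse T) X [set [set v]]].

(** The quadrilateral with corners (1,0), (1,1), (n,1), (m,0); the upper bound
    on the abscissa is the side joining (m,0) to (n,1). *)
Definition strip (R : realType) (m n : nat) : set (R * R) :=
  [set p | 0 <= p.2 <= 1 /\ 1 <= p.1 <= line_path m%:R n%:R p.2].
Arguments strip : clear implicits.

Definition strip_boundary (R : realType) (m n : nat) : set (R * R) :=
  closure (strip R m n) `\` interior (strip R m n).
Arguments strip_boundary : clear implicits.

Definition blue_vertex (R : realType) (m : nat) : set (R * R) :=
  [set p | exists2 i : nat, (1 <= i <= m)%N & p = (i%:R, 0)].
Arguments blue_vertex : clear implicits.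

Definition red_vertex (R : realType) (n : nat) : set (R * R) :=
  [set p | exists2 j : nat, (1 <= j <= n)%N & p = (j%:R, 1)].
Arguments red_vertex : clear implicits.

Definition strip_vertex (R : realType) (m n : nat) : set (R * R) :=
  blue_vertex R m `|` red_vertex R n.
Arguments strip_vertex : clear implicits.

Definition segment_path (R : realType) (u v : R * R) : R -> R * R :=
  fun t => (line_path u.1 v.1 t, line_path u.2 v.2 t).

(** The sides of the (m+n)-gon, each oriented in one way. *)
Definition oriented_edge (R : realType) (m n : nat) (u v : R * R) : Prop :=
  [\/ exists2 i : nat, (1 <= i < m)%N & u = (i%:R, 0) /\ v = (i.+1%:R, 0),
      exists2 j : nat, (1 <= j < n)%N & u = (j%:R, 1) /\ v = (j.+1%:R, 1),
      u = (1, 0) /\ v = (1, 1) |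
      u = (m%:R, 0) /\ v = (n%:R, 1)].

Definition strip_edge (R : realType) (m n : nat) (u v : R * R) : Prop :=
  oriented_edge m n u v \/ oriented_edge m n v u.

(** Paths are functions on the whole of [R], of which only the restriction to
    [0, 1] matters. *)
Definition simple_arc (R : realType) (m n : nat) (g : R -> R * R) : Prop :=
  [/\ {within `[0, 1], continuous g},
      {in `[0, 1] &, injective g},
      {in `[0, 1], forall t, strip R m n (g t)},
      {in `]0, 1[, forall t, ~ strip_boundary R m n (g t)} &
      strip_vertex R m n (g 0) /\ strip_vertex R m n (g 1)].

(** Homotopy in the disk, relative to the endpoints. *)
Definition homotopic (R : realType) (m n : nat) (g h : R -> R * R) : Prop :=
  exists H : R * R -> R * R,
    [/\ {within `[0, 1] `*` `[0, 1], continuous H},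
        {in `[0, 1] &, forall s t, strip R m n (H (s, t))},
        {in `[0, 1], forall t, H (0, t) = g t /\ H (1, t) = h t} &
        {in `[0, 1], forall s, (H (s, 0) = g 0 /\ H (s, 0) = h 0) /\
                               (H (s, 1) = g 1 /\ H (s, 1) = h 1)}].

Definition trivial_arc (R : realType) (m n : nat) (g : R -> R * R) : Prop :=
  (exists2 v, strip_vertex R m n v & homotopic m n g (cst v)) \/
  (exists u v, strip_edge m n u v /\ homotopic m n g (segment_path u v)).

(** An arc with endpoints of both colours is traversed from blue to red. *)
Definition bicoloured_arc (R : realType) (m n : nat) (g : R -> R * R) : Prop :=
  [/\ simple_arc m n g, blue_vertex R m (g 0) & red_vertex R n (g 1)].

Definition arc_class (R : realType) (m n : nat) (g : R -> R * R) :
    set (R -> R * R) :=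
  [set h | simple_arc m n h /\ homotopic m n g h].

Definition arc_classes (R : realType) (m n : nat) : set (set (R -> R * R)) :=
  [set arc_class m n g |
    g in [set g | bicoloured_arc m n g /\ ~ trivial_arc m n g]].
Arguments arc_classes : clear implicits.

Definition disjoint_arcs (R : realType) (g h : R -> R * R) : Prop :=
  {in `[0, 1] &, forall s t, g s = h t ->
    (s = 0 \/ s = 1) /\ (t = 0 \/ t = 1)}.

Definition disjoint_classes (R : realType) (C D : set (R -> R * R)) : Prop :=
  exists g h, [/\ C g, D h & disjoint_arcs g h].

Definition arc_complex (R : realType) (m n : nat) :
    set (set (set (R -> R * R))) :=
  [set s | [/\ finite_set s, s !=set0, s `<=` arc_classes R m n &
    forall C D, s C -> s D -> C <> D -> disjoint_classes C D]].
Arguments arc_complex : clear implicits.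

(* Main.v *)
Require Import Defs.
From Stdlib Require Import Relation_Operators.
From mathcomp Require Import finmap.
From mathcomp Require Import all_boot all_order all_algebra.
From mathcomp Require Import all_classical all_reals all_analysis.
From mathcomp Require Import ring lra zify.

(** The strip is convex, so two paths in it are homotopic relative to their
    endpoints exactly when they have the same endpoints ([homotopicP]).  A
    bicoloured arc from the [i]-th blue to the [j]-th red vertex is therefore
    determined up to homotopy by the pair [(i, j)], and it is trivial only when
    this pair is [(1, 1)] or [(m, n)], the two edges that join the colours.
    The vertices of the arc complex are thus the points of the grid
    [1..m] x [1..n] other than these two corners ([arc_classesE]).

    Two classes are disjoint exactly when their pairs are comparable for the
    product order ([disjoint_classesP]).  If they are comparable, the straight
    segments only meet at endpoints.  If they are not, the endpoints of the two
    arcs are in opposite orders on the two horizontal sides, and the arcs have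
    to cross.  This crossing ([arcs_cross]) is the only topological input.  It
    says that the difference [g s - h t] vanishes somewhere on the unit square:
    going along the boundary of the square from [(0, 0)] to [(1, 1)], the
    difference passes from the left to the right half plane, through the upper
    half plane one way and through the lower half plane the other way, so a
    nowhere vanishing difference would have winding number 1 along the
    boundary, hence around some arbitrarily small cell of a grid, where it
    lies in an open half plane by compactness ([square_common_zero]).

    Hence the arc complex is the flag complex of the comparability graph of the
    grid without its minimum and its maximum.  In a flag complex, a vertex all
    of whose neighbours are equal or adjacent to one of them is dominated
    ([dominated_strong_collapse]), and a cone collapses onto its apex
    ([cone_collapse]).  If [m] or [n] is 1, the poset is a chain.  Otherwise,
    the first row is removed from its last point on: [(1, k)] is dominated by
    [(1, k - 1)], and the last remaining point [(1, 2)] by [(2, 2)], which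
    differs from [(m, n)] because [m + n >= 5] ([first_row_collapse]).  What
    is left has the minimum [(2, 1)] and is a cone. *)

Set Implicit Arguments.
Unset Strict Implicit.
Unset Printing Implicit Defensive.

Import Order.TTheory GRing.Theory Num.Theory.
Import numFieldNormedType.Exports.

Local Open Scope classical_set_scope.
Local Open Scope ring_scope.

(** * Flag complexes *)

Definition clique_complex (T : Type) (r : T -> T -> Prop) (V : set T) :
    set (set T) :=
  [set s | [/\ finite_set s, s !=set0, s `<=` V &
    forall u v, s u -> s v -> u <> v -> r u v]].

Lemma clique_complex_simplicial (T : Type) (r : T -> T -> Prop) (V : set T) :
  simplicial_complex (clique_complex r V).
Proof.
split=> [s [sfin s0 _ _]//|s t [sfin _ sV sr] ts t0]; split => //.
- exact: sub_finite_set sfin.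
- exact: subset_trans sV.
- by move=> u v /ts su /ts sv; exact: sr.
Qed.

Lemma finite_powerset (T : Type) (A : set T) :
  finite_set A -> finite_set [set B | B `<=` A].
Proof.
elim/Pchoice: T => T in A *; move=> /finite_fsetP[X ->].
apply: (@sub_finite_set _ _ ((fun Y : {fset T} => [set` Y]) @` [set` fpowerset X])).
  move=> B BX; exists (fset_set B).
    by rewrite /= fpowersetE; apply/fsubsetP => x; rewrite in_fset_set ?inE;
      [move/BX|exact: sub_finite_set BX _].
  by rewrite fset_setK //; exact: sub_finite_set BX _.
exact: finite_image.
Qed.

Lemma clique_complex_finite (T : Type) (r : T -> T -> Prop) (V : set T) :
  finite_set V -> finite_set (clique_complex r V).
Proof. by move=> /finite_powerset; apply: sub_finite_set => s []. Qed.

Lemma clique_complex_deletion (T : Type) (r : T -> T -> Prop) (V : set T) v :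
  deletion (clique_complex r V) v = clique_complex r (V `\ v).
Proof.
apply/seteqP; split=> s.
  move=> [[sfin s0 sV sr] nsv]; split => // u su; split; first exact: sV.
  by move=> /= uv; apply: nsv; rewrite -uv.
move=> [sfin s0 sV sr]; split; last by move=> /sV[_]; exact.
by split => // u /sV[].
Qed.

Lemma clique_complex_vertex (T : Type) (r : T -> T -> Prop) (V : set T) v :
  V v -> clique_complex r V [set v].
Proof.
move=> Vv; split; [exact: finite_set1|by exists v|by move=> _ ->|].
by move=> _ _ -> ->.
Qed.

Lemma clique_complexU1 (T : Type) (r : T -> T -> Prop) (V s : set T) v :
  (forall a b, r a b -> r b a) ->
  V v -> clique_complex r V s -> (forall u, s u -> u <> v -> r v u) ->
  clique_complex r V (v |` s).
Proof.
move=> rC Vv [sfin s0 sV sr] vr; split.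
- by rewrite finite_setU; split => //; exact: finite_set1.
- by exists v; left.
- by move=> u [->//|/sV].
- move=> a b [->|sa] [->//|sb] ab.
  + by apply: vr => // ba; apply: ab.
  + by apply/rC/vr.
  + exact: sr.
Qed.

(** The link of [v] is the join of [v'] with the simplices of the link that
    avoid [v']: adding [v'] to a simplex of the link gives a simplex of the
    link, because every neighbour of [v] is equal or adjacent to [v']. *)
Lemma dominated_strong_collapse (T : Type) (r : T -> T -> Prop) (V : set T)
    v v' :
  (forall a b, r a b -> r b a) ->
  V v -> V v' -> v' <> v -> r v v' ->
  (forall u, V u -> u <> v' -> r v u -> r v' u) ->
  strong_collapse (clique_complex r V) (clique_complex r (V `\ v)).
Proof.
move=> rC Vv Vv' v'v rvv' dom.
exists v; last by rewrite clique_complex_deletion.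
split; first exact: clique_complex_vertex.
exists v'; exists [set s | link (clique_complex r V) v s /\ ~ s v'].
have linkr s u : link (clique_complex r V) v s -> s u -> r v u.
  move=> [_ sv [_ _ _ vr]] su; apply: vr; [by left|by right|].
  by move=> vu; apply: sv; rewrite vu.
have [simpl1 simpl2] := clique_complex_simplicial r V.
have linkS s t : link (clique_complex r V) v s -> t `<=` s -> t !=set0 ->
    link (clique_complex r V) v t.
  move=> [Xs sv Xvs] ts t0; split; [exact: simpl2 ts t0|by move/ts|].
  by apply: (simpl2 _ _ Xvs); [exact: setUS|exists v; left].
have linkU s : link (clique_complex r V) v s ->
    link (clique_complex r V) v (v' |` s).
  move=> ls; have [Xs sv Xvs] := ls; split.
  - apply: clique_complexU1 => // u su uv'.
    by apply: dom => //; [case: Xs => _ _ + _; exact|exact: linkr ls su].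
  - by move=> [vv'|//]; apply: v'v; rewrite -vv'.
  - rewrite setUCA; apply: clique_complexU1 => // u [-> _|su uv'].
      exact: rC.
    by apply: dom => //; [case: Xs => _ _ + _; exact|exact: linkr ls su].
split => //.
- exact: clique_complex_vertex.
- split; last by move=> s [[]].
  split; first by move=> s [[/simpl1]].
  move=> s t [ls sv'] ts t0; split; first exact: linkS ls ts t0.
  by move=> /ts.
- by move=> s [].
apply/seteqP; split=> s.
  move=> ls; have [sv'|sv'] := pselect (s v'); last by left; right.
  have [[w [sw wv']]|sE] := pselect (s `\ v' !=set0).
    right; exists [set v'] => //; exists (s `\ v').
      split; last by move=> [_]; exact.
      by apply: linkS ls _ _; [exact: subDsetl|exists w].
    by rewrite setDUK// => _ ->.
  left; left; apply/seteqP; split=> [w sw /=|_ ->//].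
  by apply: contrapT => wv'; apply: sE; exists w.
have linkv' : link (clique_complex r V) v [set v'].
  split; [exact: clique_complex_vertex|by move=> /esym|].
  apply: clique_complexU1 => //; first exact: clique_complex_vertex.
  by move=> _ -> _.
by move=> [[-> //|[]//]|[_ -> [t [lt _] <-]]]; exact: linkU.
Qed.

Lemma clique_complex1 (T : Type) (r : T -> T -> Prop) (a : T) :
  clique_complex r [set a] = [set [set a]].
Proof.
apply/seteqP; split=> s; last by move=> ->; exact: clique_complex_vertex.
move=> [_ [b sb] sa _]; apply/seteqP; split=> // _ ->.
by rewrite -(sa _ sb).
Qed.

(** The apex dominates every other vertex, and it still does after some of them
    have been deleted, so that they can be removed one at a time. *)
Lemma cone_collapse (T : Type) (r : T -> T -> Prop) (V : set T) a :
  (forall x y, r x y -> r y x) ->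
  finite_set V -> V a -> (forall u, V u -> u <> a -> r a u) ->
  clos_refl_trans _ (@strong_collapse T) (clique_complex r V) [set [set a]].
Proof.
elim/Pchoice: T => T in r V a *; move=> rC.
move=> /finite_seqP[s Vs] Va ar.
have {Vs} : V = a |` [set` s] by rewrite -Vs setUidr// => _ ->.
elim: s V {Va} ar => [|b s IHs] V ar Vs.
  rewrite Vs set_nil setU0 clique_complex1; exact: rt_refl.
have {}Vs : V = b |` (a |` [set` s]).
  rewrite Vs setUCA; congr (_ `|` _); apply/seteqP; split=> x /=; rewrite inE.
    by move=> /orP[/eqP|]; [left|right].
  by move=> [->|->]; rewrite ?eqxx ?orbT.
have [bs|bs] := pselect ((a |` [set` s]) b).
  by apply: IHs => //; rewrite Vs setUidr// => _ ->.
have ab : a <> b by move=> /esym ba; apply: bs; left.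
have Vb : V `\ b = a |` [set` s].
  rewrite Vs; apply/seteqP; split=> x.
    by move=> [[]].
  by move=> xs; split; [right|move=> xb; apply: bs; rewrite -xb].
apply: (rt_trans _ _ _ (clique_complex r (V `\ b))); last first.
  by apply: IHs => // u [Vu _]; exact: ar.
apply: rt_step; apply: (@dominated_strong_collapse _ r V b a) => //.
- by rewrite Vs; left.
- by rewrite Vs; right; left.
- apply/rC/ar; last exact/nesym.
  by rewrite Vs; left.
- by move=> u Vu ua _; exact: ar.
Qed.

(** * Paths that have to cross *)

(** Discrete Green theorem: if a cochain on the oriented edges of a grid has
    zero circulation around each cell, then it has the same sum along the two
    monotone boundary paths between opposite corners. *)
Lemma grid_circulation (V : zmodType) (w_h w_v : nat -> nat -> V) (k l : nat) :
  (forall i j, (i < k)%N -> (j < l)%N ->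
    w_h i j + w_v i.+1 j = w_v i j + w_h i j.+1) ->
  \sum_(i < k) w_h i 0%N + \sum_(j < l) w_v k j =
  \sum_(j < l) w_v 0%N j + \sum_(i < k) w_h i l.
Proof.
elim: l => [|l IHl] cell; first by rewrite !big_ord0 addr0 add0r.
rewrite !big_ord_recr /= addrA IHl; last first.
  by move=> i j ik jl; apply: cell => //; lia.
rewrite -!addrA; congr (_ + _).
have {IHl} : forall i, (i < k)%N -> w_h i l + w_v i.+1 l = w_v i l + w_h i l.+1.
  by move=> i ik; exact: cell.
elim: k {cell} => [|k IHk] cell; first by rewrite !big_ord0 addr0 add0r.
rewrite !big_ord_recr /= -addrA cell // [LHS]addrA IHk ?addrA //.
by move=> i ik; apply: cell; lia.
Qed.

(** Half planes bounded by a coordinate axis suffice: near a point where [X] and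
    [Y] do not both vanish, one of them keeps a constant sign. *)
Definition in_open_halfplane (R : realType) (I : Type) (X Y : I -> R)
    (A : set I) :=
  [\/ forall p, A p -> 0 < X p, forall p, A p -> X p < 0,
      forall p, A p -> 0 < Y p | forall p, A p -> Y p < 0].

Lemma in_open_halfplaneS (R : realType) (I : Type) (X Y : I -> R)
    (A B : set I) :
  A `<=` B -> in_open_halfplane X Y B -> in_open_halfplane X Y A.
Proof.
by move=> AB [] H; [apply: Or41|apply: Or42|apply: Or43|apply: Or44] => p /AB/H.
Qed.

(** Signed number of times that a short step from [p] to [q] crosses the
    negative vertical half axis from left to right.  Its sum along a loop that
    avoids the origin is the winding number. *)
Definition negative_ordinate_crossing (R : realType) (p q : R * R) : int :=
  if (p.2 < 0) && (q.2 < 0) then ((0 < q.1)%R)%:Z - ((0 < p.1)%R)%:Z else 0.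

(** The crossing numbers add up to 0 along the path on the lower and right
    sides, which stays in the closed upper half plane.  Along the left and
    upper sides they telescope to the change of the truth value of [0 < x],
    which is 1.  Around a cell whose image lies in a half plane they add up to
    0, a contradiction. *)
Lemma grid_no_winding (R : realType) (N : nat) (F : nat -> nat -> R * R) :
  (forall i j, (i < N)%N -> (j < N)%N ->
    in_open_halfplane fst snd
      [set F i j; F i.+1 j; F i j.+1; F i.+1 j.+1]) ->
  (forall i, (i <= N)%N -> 0 <= (F i 0%N).2 /\ 0 <= (F N i).2) ->
  (forall i, (i <= N)%N -> (F 0%N i).2 <= 0 /\ (F i N).2 <= 0) ->
  (F 0%N 0%N).1 < 0 -> 0 < (F N N).1 -> False.
Proof.
move=> cell lower upper x00 xNN.
have cross0 p q : 0 <= p.2 -> negative_ordinate_crossing p q = 0.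
  by rewrite /negative_ordinate_crossing ltNge => ->.
(* If an endpoint of the step is on the horizontal axis, the half plane
   containing the step is the left or the right one: both sides are 0. *)
have crossE p q : p.2 <= 0 -> q.2 <= 0 ->
    in_open_halfplane fst snd [set p; q] ->
    negative_ordinate_crossing p q = ((0 < q.1)%R)%:Z - ((0 < p.1)%R)%:Z.
  move=> yp yq; rewrite /negative_ordinate_crossing => -[] H;
    have := H p (or_introl erefl); have := H q (or_intror erefl).
  - by move=> -> ->; rewrite subrr if_same.
  - move=> /ltW + /ltW; rewrite !leNgt => /negbTE-> /negbTE->.
    by rewrite if_same.
  - by move=> _; rewrite ltNge yp.
  - by move=> -> ->.
pose wh i j := negative_ordinate_crossing (F i j) (F i.+1 j).
pose wv i j := negative_ordinate_crossing (F i j) (F i j.+1).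
have /(@grid_circulation _ wh wv N N) : forall i j, (i < N)%N -> (j < N)%N ->
    wh i j + wv i.+1 j = wv i j + wh i j.+1.
  move=> i j iN jN; rewrite /wh /wv /negative_ordinate_crossing.
  have corners (P : R * R -> Prop) :
      (forall p, [set F i j; F i.+1 j; F i j.+1; F i.+1 j.+1] p -> P p) ->
      [/\ P (F i j), P (F i.+1 j), P (F i j.+1) & P (F i.+1 j.+1)].
    by move=> PF; split; apply: PF => /=; tauto.
  have [] := cell i j iN jN => /corners[].
  - by move=> -> -> -> ->; rewrite subrr !if_same.
  - move=> /ltW + /ltW + /ltW + /ltW; rewrite !leNgt.
    by move=> /negbTE-> /negbTE-> /negbTE-> /negbTE->; rewrite subrr !if_same.
  - move=> /ltW + /ltW + /ltW + /ltW; rewrite !leNgt.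
    by move=> /negbTE-> /negbTE-> /negbTE-> /negbTE->.
  - move=> -> -> -> ->; rewrite /=; ring.
have -> : \sum_(i < N) wh i 0%N = 0.
  by apply: big1 => i _; apply: cross0; case: (lower i (ltnW (ltn_ord i))).
have -> : \sum_(j < N) wv N j = 0.
  by apply: big1 => j _; apply: cross0; case: (lower j (ltnW (ltn_ord j))).
pose u i j : int := ((0 < (F i j).1)%R)%:Z.
have -> : \sum_(j < N) wv 0%N j = u 0%N N - u 0%N 0%N.
  rewrite -(telescope_sumr (u 0%N)) // big_mkord; apply: eq_bigr => j _.
  have jN := ltn_ord j; apply: crossE.
  - by case: (upper j (ltnW jN)).
  - by case: (upper j.+1 jN).
  - apply: in_open_halfplaneS (cell 0%N j (leq_ltn_trans (leq0n j) jN) jN).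
    by move=> p /=; tauto.
have -> : \sum_(i < N) wh i N = u N N - u 0%N N.
  rewrite -(telescope_sumr (u^~ N)) // big_mkord; apply: eq_bigr => i _.
  have iN := ltn_ord i; apply: crossE.
  - by case: (upper i (ltnW iN)).
  - by case: (upper i.+1 iN).
  - have N0 := leq_ltn_trans (leq0n i) iN.
    have := cell i N.-1 iN; rewrite prednK // => /(_ (leqnn N)).
    by apply: in_open_halfplaneS => p /=; tauto.
by rewrite addr0 [RHS]addrC subrKA /u xNN ltNge (ltW x00).
Qed.

Lemma within_ball_preimage (R : realType) (T : topologicalType) (Z : R * R -> T)
    (K : set (R * R)) (p : R * R) (O : set T) :
  {within K, continuous Z} -> K p -> open O -> O (Z p) ->
  exists2 e : R, 0 < e & ball p e `&` K `<=` Z @^-1` O.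
Proof.
move=> /subspace_continuousP cZ Kp oO OZp.
have /(cZ _ Kp)/nbhs_ballP[e e0 pe] : nbhs (Z p) O by exact: open_nbhs_nbhs.
by exists e => // q [/pe].
Qed.

(** A Lebesgue number for the cover of [K] by the open sets on which one of the
    two functions has a constant sign. *)
Lemma nonzero_halfplane_mesh (R : realType) (X Y : R * R -> R)
    (K : set (R * R)) :
  compact K -> {within K, continuous X} -> {within K, continuous Y} ->
  (forall p, K p -> ~ (X p = 0 /\ Y p = 0)) ->
  exists2 e : R, 0 < e & forall p, K p -> in_open_halfplane X Y (ball p e `&` K).
Proof.
move=> cK cX cY n0.
have local p : K p ->
    exists2 e : R, 0 < e & in_open_halfplane X Y (ball p e `&` K).
  move=> Kp; have [X0|X0|X0] := ltgtP (X p) 0.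
  - have [e e0 H] := within_ball_preimage cX Kp (@open_lt _ 0) X0.
    by exists e => //; apply: Or42.
  - have [e e0 H] := within_ball_preimage cX Kp (@open_gt _ 0) X0.
    by exists e => //; apply: Or41.
  have [Y0|Y0|Y0] := ltgtP (Y p) 0.
  - have [e e0 H] := within_ball_preimage cY Kp (@open_lt _ 0) Y0.
    by exists e => //; apply: Or44.
  - have [e e0 H] := within_ball_preimage cY Kp (@open_gt _ 0) Y0.
    by exists e => //; apply: Or43.
  by case: (n0 p Kp).
have /compact_near_coveringP/(_ R (0:R)^'+
  (fun e p => in_open_halfplane X Y (ball p e `&` K))) := cK.
have /[swap]/[apply] : forall x, K x -> \forall x' \near x & i \near (0:R)^'+,
    in_open_halfplane X Y (ball x' i `&` K).
  move=> p /local[e e0 H]; have e20 : 0 < e / 2 by rewrite divr_gt0.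
  exists (ball p (e / 2), [set x | x < e / 2]).
    by split; [exact: nbhsx_ballx|exact: nbhs_right_lt].
  move=> [q d] /= [pq de]; apply: in_open_halfplaneS H; apply: setSI => x qx.
  rewrite (splitr e); apply: ball_triangle pq _; apply: le_ball qx; exact: ltW.
move=> H; near (0:R)^'+ => e; exists e => //.
by near: e.
Unshelve. all: by end_near. Qed.

(** A form of the Poincare-Miranda theorem: the sign conditions make the
    boundary curve of the square wind once around the origin. *)
Lemma square_common_zero (R : realType) (X Y : R * R -> R) :
  let K := `[0, 1]%classic `*` `[0, 1]%classic in
  {within K, continuous X} -> {within K, continuous Y} ->
  {in `[0, 1], forall s, 0 <= Y (s, 0) /\ 0 <= Y (1, s)} ->
  {in `[0, 1], forall s, Y (0, s) <= 0 /\ Y (s, 1) <= 0} ->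
  X (0, 0) < 0 -> 0 < X (1, 1) ->
  exists p, [/\ K p, X p = 0 & Y p = 0].
Proof.
move=> K cX cY lower upper X00 X11; apply: contrapT => n0.
have cK : compact K by apply: compact_setX; exact: segment_compact.
have [e e0 mesh] : exists2 e : R, 0 < e &
    forall p, K p -> in_open_halfplane X Y (ball p e `&` K).
  apply: nonzero_halfplane_mesh => // p Kp [Xp Yp].
  by apply: n0; exists p.
have [N Ne] : exists N : nat, (N.+1)%:R^-1 < e.
  have [N _ /(_ N (leqnn N))] := near_infty_natSinv_lt (PosNum e0).
  by exists N.
pose t i : R := i%:R / N.+1%:R.
have t01 i : (i <= N.+1)%N -> t i \in `[0, 1].
  move=> iN; rewrite in_itv /= /t divr_ge0 ?ler0n //=.
  by rewrite ler_pdivrMr ?mul1r ?ler_nat ?ltr0n.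
have t0 : t 0%N = 0 by rewrite /t mul0r.
have t1 : t N.+1 = 1 by rewrite /t divff ?pnatr_eq0.
have tS i : t i.+1 - t i = N.+1%:R^-1.
  by rewrite /t -mulrBl -natr1 addrAC subrr add0r mul1r.
have KF i j : (i <= N.+1)%N -> (j <= N.+1)%N -> K (t i, t j).
  by move=> iN jN; split; exact: t01.
pose F i j := (X (t i, t j), Y (t i, t j)).
apply: (@grid_no_winding _ N.+1 F); rewrite /F /= ?t0 ?t1 //.
- move=> i j iN jN.
  have Kij : K (t i, t j) by apply: KF; exact: ltnW.
  suff sub : [set (t i, t j); (t i.+1, t j); (t i, t j.+1); (t i.+1, t j.+1)]
      `<=` ball (t i, t j) e `&` K.
    have := in_open_halfplaneS sub (mesh _ Kij).
    by case=> H; [apply: Or41|apply: Or42|apply: Or43|apply: Or44];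
      move=> p /= [[[->|->]|->]|->] /=; apply: H => /=; tauto.
  have tb k : ball (t k) e (t k) by exact: ballxx.
  have tbS k : ball (t k) e (t k.+1).
    by rewrite -ball_normE /= distrC tS ger0_norm // invr_ge0.
  by move=> p /= [[[->|->]|->]|->];
    (split; [split; first [exact: tb | exact: tbS] | apply: KF; lia]).
- by move=> i /t01 it; have [? _] := lower _ it; have [_ ?] := lower _ it.
- by move=> i /t01 it; have [? _] := upper _ it; have [_ ?] := upper _ it.
Qed.

Lemma within_continuous_fst (R : realType) (T : topologicalType)
    (A B : set R) (g : R -> T) :
  {within A, continuous g} -> {within A `*` B, continuous (g \o fst)}.
Proof.
move=> /subspace_continuousP cg; apply/subspace_continuousP => -[s t] [/= As Bt].
move=> W /(cg s As) gW.
have : \forall q \near (s, t), A q.1 -> W (g q.1).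
  exact: (@cvg_fst _ _ (nbhs s) (nbhs t) _ _ gW).
by apply: filterS => q Wq [Aq _]; exact: Wq.
Qed.

Lemma within_continuous_snd (R : realType) (T : topologicalType)
    (A B : set R) (g : R -> T) :
  {within B, continuous g} -> {within A `*` B, continuous (g \o snd)}.
Proof.
move=> /subspace_continuousP cg; apply/subspace_continuousP => -[s t] [/= As Bt].
move=> W /(cg t Bt) gW.
have : \forall q \near (s, t), B q.2 -> W (g q.2).
  exact: (@cvg_snd _ _ (nbhs s) (nbhs t) _ _ gW).
by apply: filterS => q Wq [_ Bq]; exact: Wq.
Qed.

(** A common point of the two paths is a zero of [g s - h t] on the unit square.
    The paths stay between the two horizontal lines that carry their endpoints,
    which gives the signs of the ordinate of the difference on the sides of
    the square, and the endpoints are in opposite orders on the two lines,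
    which gives the signs of its abscissa at the corners. *)
Lemma arcs_cross (R : realType) (g h : R -> R * R) :
  {within `[0, 1], continuous g} -> {within `[0, 1], continuous h} ->
  {in `[0, 1], forall t, 0 <= (g t).2 <= 1} ->
  {in `[0, 1], forall t, 0 <= (h t).2 <= 1} ->
  (g 0).2 = 0 -> (h 0).2 = 0 -> (g 1).2 = 1 -> (h 1).2 = 1 ->
  (g 0).1 < (h 0).1 -> (h 1).1 < (g 1).1 ->
  exists s t, [/\ s \in `[0, 1], t \in `[0, 1] & g s = h t].
Proof.
move=> cg ch g01 h01 g0 h0 g1 h1 gh0 hg1.
have cG := @within_continuous_fst _ _ _ `[0, 1]%classic _ cg.
have cH := @within_continuous_snd _ _ `[0, 1]%classic _ _ ch.
have [|||||//|[s t] [[s01 t01] /eqP Xst /eqP Yst]] := @square_common_zero _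
  (fun p => (g p.1).1 - (h p.2).1) (fun p => (g p.1).2 - (h p.2).2).
- move=> p; apply: cvgB.
    by apply: (cvg_comp _ _ (cG p)); exact: cvg_fst.
  by apply: (cvg_comp _ _ (cH p)); exact: cvg_fst.
- move=> p; apply: cvgB.
    by apply: (cvg_comp _ _ (cG p)); exact: cvg_snd.
  by apply: (cvg_comp _ _ (cH p)); exact: cvg_snd.
- move=> s s01 /=; rewrite h0 g1 subr0 subr_ge0.
  by have /andP[-> _] := g01 s s01; have /andP[_ ->] := h01 s s01.
- move=> s s01 /=; rewrite g0 h1 sub0r oppr_le0 subr_le0.
  by have /andP[_ ->] := g01 s s01; have /andP[-> _] := h01 s s01.
- by rewrite /= subr_lt0.
- by rewrite /= subr_gt0.
exists s, t; split => //.
rewrite !subr_eq0 in Xst Yst.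
by rewrite [LHS]surjective_pairing [RHS]surjective_pairing (eqP Xst) (eqP Yst).
Qed.

(** * Homotopy classes of arcs in the strip *)

Lemma unit_interval0 (R : realType) : (0 : R) \in `[0, 1].
Proof. by rewrite in_itv /= lexx ler01. Qed.

Lemma strip_convex (R : realType) (m n : nat) (p q : R * R) (t : R) :
  strip R m n p -> strip R m n q -> t \in `[0, 1] ->
  strip R m n (segment_path p q t).
Proof.
case: p q => [px py] [qx qy]; rewrite /strip /segment_path /line_path /= in_itv /=.
move=> [/andP[py0 py1] /andP[px1 pxl]] [/andP[qy0 qy1] /andP[qx1 qxl]] /andP[t0 t1].
split; apply/andP; split; nra.
Qed.

Lemma segment_path0 (R : realType) (p q : R * R) : segment_path p q 0 = p.
Proof. by rewrite /segment_path !line_path0 -surjective_pairing. Qed.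

Lemma segment_path1 (R : realType) (p q : R * R) : segment_path p q 1 = q.
Proof. by rewrite /segment_path !line_path1 -surjective_pairing. Qed.

Lemma segment_path_flat (R : realType) (p : R * R) t : segment_path p p t = p.
Proof. by rewrite /segment_path !line_path_flat /= -surjective_pairing. Qed.

Lemma cvg_segment_path (R : realType) (T : Type) (F : set_system T)
    (FF : Filter F) (f g : T -> R * R) (u : T -> R) (a b : R * R) (c : R) :
  f @ F --> a -> g @ F --> b -> u @ F --> c ->
  segment_path (f x) (g x) (u x) @[x --> F] --> segment_path a b c.
Proof.
move=> fa gb uc; rewrite /segment_path /line_path.
apply: (@cvg_pair _ _ _ F (nbhs _) (nbhs _)); apply: cvgD; apply: cvgM => //.
- by apply: cvgB => //; exact: cvg_cst.
- by apply: (cvg_comp _ _ fa); exact: cvg_fst.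
- by apply: (cvg_comp _ _ gb); exact: cvg_fst.
- by apply: cvgB => //; exact: cvg_cst.
- by apply: (cvg_comp _ _ fa); exact: cvg_snd.
- by apply: (cvg_comp _ _ gb); exact: cvg_snd.
Qed.

Lemma continuous_segment_path (R : realType) (p q : R * R) :
  continuous (segment_path p q).
Proof. by move=> t; apply: cvg_segment_path; [exact: cvg_cst|exact: cvg_cst|]. Qed.

(** As the strip is convex, the straight-line homotopy stays in it. *)
Lemma homotopicP (R : realType) (m n : nat) (g h : R -> R * R) :
  {within `[0, 1], continuous g} -> {within `[0, 1], continuous h} ->
  {in `[0, 1], forall t, strip R m n (g t)} ->
  {in `[0, 1], forall t, strip R m n (h t)} ->
  homotopic m n g h <-> g 0 = h 0 /\ g 1 = h 1.
Proof.
move=> cg ch gS hS; split=> [[H [_ _ _ /(_ 0 (unit_interval0 R))]]|[gh0 gh1]].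
  by move=> [[<- ->] [<- ->]].
exists (fun p => segment_path (g p.2) (h p.2) p.1); split.
- have cG := @within_continuous_snd _ _ `[0, 1]%classic _ _ cg.
  have cH := @within_continuous_snd _ _ `[0, 1]%classic _ _ ch.
  have c1 : {within `[0, 1]%classic `*` `[0, 1]%classic,
    continuous (@fst R R)}.
    apply: (@within_continuous_fst R _ _ _ id).
    by apply: continuous_subspaceT => x.
  by move=> p; apply: cvg_segment_path; [exact: cG|exact: cH|exact: c1].
- by move=> s t s01 t01 /=; apply: strip_convex => //; [exact: gS|exact: hS].
- by move=> t t01 /=; rewrite segment_path0 segment_path1.
- by move=> s s01 /=; rewrite -gh0 -gh1 !segment_path_flat.
Qed.

Lemma strip_interior_point (R : realType) (m n : nat) (p : R * R) :
  0 < p.2 < 1 -> 1 < p.1 < line_path m%:R n%:R p.2 ->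
  interior (strip R m n) p.
Proof.
move=> /andP[p20 p21] /andP[p11 p1l].
have near_gt0 (f : R * R -> R) : f q @[q --> p] --> f p -> 0 < f p ->
    \forall q \near p, 0 < f q.
  by move=> cf f0; exact: (cvgr_gt _ cf).
have c1 : {for p, continuous (@fst R R)} by exact: cvg_fst.
have c2 : {for p, continuous (@snd R R)} by exact: cvg_snd.
have cl : {for p, continuous (fun q : R * R => line_path m%:R n%:R q.2 - q.1)}.
  rewrite /continuous_at /line_path; apply: cvgB; last exact: c1.
  apply: cvgD; apply: cvgM; try exact: cvg_cst; try exact: c2.
  by apply: cvgB; [exact: cvg_cst|exact: c2].
near=> q; split; apply/andP; split.
- by apply: ltW; near: q; exact: near_gt0.
- rewrite -subr_ge0; apply: ltW; near: q; apply: (near_gt0 (fun q => 1 - q.2)).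
    by apply: cvgB; [exact: cvg_cst|exact: c2].
  by rewrite subr_gt0.
- rewrite -subr_ge0; apply: ltW; near: q; apply: (near_gt0 (fun q => q.1 - 1)).
    by apply: cvgB; [exact: c1|exact: cvg_cst].
  by rewrite subr_gt0.
- rewrite -subr_ge0; apply: ltW; near: q.
  by apply: (near_gt0 _ cl); rewrite subr_gt0.
Unshelve. all: by end_near. Qed.

Definition blue_point (R : realType) (i : nat) : R * R := (i%:R, 0).
Definition red_point (R : realType) (j : nat) : R * R := (j%:R, 1).

(** By [homotopicP], this is the homotopy class of any of its elements; see
    [arc_class_bicoloured]. *)
Definition bicoloured_class (R : realType) (m n : nat) (p : nat * nat) :
    set (R -> R * R) :=
  [set g | [/\ simple_arc m n g, g 0 = blue_point R p.1 & g 1 = red_point R p.2]].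
Arguments bicoloured_class : clear implicits.

(** The two excluded pairs are those of the edges with endpoints of both
    colours. *)
Definition strip_diagonal (m n : nat) : set (nat * nat) :=
  [set p | [/\ (1 <= p.1 <= m)%N, (1 <= p.2 <= n)%N, p <> (1%N, 1%N) &
    p <> (m, n)]].

Lemma blue_point_inj (R : realType) : injective (@blue_point R).
Proof. by move=> i j [/eqP]; rewrite eqr_nat => /eqP. Qed.

Lemma red_point_inj (R : realType) : injective (@red_point R).
Proof. by move=> i j [/eqP]; rewrite eqr_nat => /eqP. Qed.

Lemma blue_neq_red (R : realType) i j : blue_point R i <> red_point R j.
Proof. by move=> [_ /eqP]; rewrite eq_sym oner_eq0. Qed.

Lemma red_neq_blue (R : realType) i j : red_point R j <> blue_point R i.
Proof. exact/nesym/blue_neq_red. Qed.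

Lemma strip_blue_point (R : realType) (m n i : nat) :
  (1 <= i <= m)%N -> strip R m n (blue_point R i).
Proof.
move=> /andP[i1 im]; split; rewrite /= ?lexx ?ler01 //.
by rewrite line_path0 ler1n i1 ler_nat.
Qed.

Lemma strip_red_point (R : realType) (m n j : nat) :
  (1 <= j <= n)%N -> strip R m n (red_point R j).
Proof.
move=> /andP[j1 jn]; split; rewrite /= ?lexx ?ler01 //.
by rewrite line_path1 ler1n j1 ler_nat.
Qed.

Lemma strip_vertex_strip (R : realType) (m n : nat) (v : R * R) :
  strip_vertex R m n v -> strip R m n v.
Proof.
by move=> [[i im ->]|[j jn ->]]; [exact: strip_blue_point|exact: strip_red_point].
Qed.

Lemma oriented_edge_strip (R : realType) (m n : nat) (u v : R * R) :
  (1 <= m)%N -> (1 <= n)%N ->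
  oriented_edge m n u v -> strip R m n u /\ strip R m n v.
Proof.
move=> m1 n1 [] => [[i im [-> ->]]|[j jn [-> ->]]|[-> ->]|[-> ->]].
- by split; apply: strip_blue_point; lia.
- by split; apply: strip_red_point; lia.
- split; [apply: (@strip_blue_point _ _ _ 1)|apply: (@strip_red_point _ _ _ 1)].
    by rewrite m1.
  by rewrite n1.
- by split; [apply: strip_blue_point|apply: strip_red_point]; rewrite leqnn andbT.
Qed.

Lemma segment_path_strip (R : realType) (m n : nat) (u v : R * R) :
  strip R m n u -> strip R m n v ->
  {in `[0, 1], forall t, strip R m n (segment_path u v t)}.
Proof. by move=> uS vS t; exact: strip_convex. Qed.

Lemma trivial_bicolouredP (R : realType) (m n : nat) (p : nat * nat)
    (g : R -> R * R) :
  (1 <= m)%N -> (1 <= n)%N -> bicoloured_class R m n p g ->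
  trivial_arc m n g <-> p = (1%N, 1%N) \/ p = (m, n).
Proof.
move=> m1 n1 [[cg _ gS _ _] g0 g1].
have hom_segment u v : strip R m n u -> strip R m n v ->
    homotopic m n g (segment_path u v) <->
    blue_point R p.1 = u /\ red_point R p.2 = v.
  move=> uS vS; rewrite homotopicP //; last exact: segment_path_strip.
    by rewrite segment_path0 segment_path1 g0 g1.
  by apply: continuous_subspaceT => x; exact: continuous_segment_path.
split=> [[[v /strip_vertex_strip vS]|[u [v [uv]]]]|pE].
- have -> : cst v = segment_path v v by apply/funext => t; rewrite segment_path_flat.
  by move=> /hom_segment[]// <- /red_neq_blue.
- have [uS vS] : strip R m n u /\ strip R m n v.
    by case: uv => /oriented_edge_strip[].
  move=> /hom_segment[]// uE vE; case: uv; rewrite -{}uE -{}vE => -[].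
  + by move=> [i _ [_ /red_neq_blue]].
  + by move=> [i _ [/blue_neq_red]].
  + move=> [/(@blue_point_inj R _ 1) p1 /(@red_point_inj R _ 1) p2].
    by left; rewrite [LHS]surjective_pairing p1 p2.
  + move=> [/blue_point_inj p1 /red_point_inj p2].
    by right; rewrite [LHS]surjective_pairing p1 p2.
  + by move=> [i _ [/red_neq_blue]].
  + by move=> [i _ [_ /blue_neq_red]].
  + by move=> [/(@red_neq_blue _ 1)].
  + by move=> [/red_neq_blue].
- right; exists (blue_point R p.1), (red_point R p.2).
  have edge : oriented_edge m n (blue_point R p.1) (red_point R p.2).
    by case: pE => ->; [apply: Or43|apply: Or44].
  by have [uS vS] := oriented_edge_strip m1 n1 edge; split; [left|apply/hom_segment].
Qed.

Lemma arc_class_bicoloured (R : realType) (m n : nat) (p : nat * nat)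
    (g : R -> R * R) :
  bicoloured_class R m n p g -> arc_class m n g = bicoloured_class R m n p.
Proof.
move=> [[cg _ gS _ _] g0 g1]; apply/seteqP; split=> h.
  move=> [hs]; have [ch _ hS _ _] := hs.
  by move=> /homotopicP[]// gh0 gh1; split; rewrite // -?gh0 -?gh1.
move=> [hs h0 h1]; have [ch _ hS _ _] := hs; split=> //.
by apply/homotopicP => //; rewrite g0 g1 h0 h1.
Qed.

(** The segment of a pair other than [(1, 1)] and [(m, n)] has one end away from
    the left side of the strip and one end away from the right side, so that its
    interior points are interior points of the strip. *)
Lemma segment_bicoloured (R : realType) (m n : nat) (p : nat * nat) :
  strip_diagonal m n p ->
  bicoloured_class R m n p (segment_path (blue_point R p.1) (red_point R p.2)).
Proof.
case: p => i j [/= im jn ij1 ijmn].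
have iS := strip_blue_point R n im; have jS := strip_red_point R m jn.
rewrite /bicoloured_class /= segment_path0 segment_path1; split => //; split.
- by apply: continuous_subspaceT => x; exact: continuous_segment_path.
- by move=> s t _ _ [_]; rewrite /line_path; lra.
- exact: segment_path_strip.
- move=> t; rewrite in_itv /= => /andP[t0 t1] [_]; apply.
  apply: strip_interior_point; rewrite /= line_path_id; first by rewrite t0.
  rewrite /line_path; case/andP: im => i1 im; case/andP: jn => j1 jn.
  have {}im' : i%:R <= m%:R :> R by rewrite ler_nat.
  have {}jn' : j%:R <= n%:R :> R by rewrite ler_nat.
  have i1' : 1 <= i%:R :> R by rewrite ler1n.
  have j1' : 1 <= j%:R :> R by rewrite ler1n.
  apply/andP; split.
    have [i2|j2] : (2 <= i \/ 2 <= j)%N.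
      case: (ltnP 1 i); [by left|case: (ltnP 1 j); [by right|]] => j0 i0.
      by case: ij1; congr (_, _); lia.
    + have : 2 <= i%:R :> R by rewrite ler_nat.
      by nra.
    + have : 2 <= j%:R :> R by rewrite ler_nat.
      by nra.
  have [i2|j2] : (i < m \/ j < n)%N.
    case: (ltnP i m); [by left|case: (ltnP j n); [by right|]] => j0 i0.
    by case: ijmn; congr (_, _); lia.
  + have : i%:R + 1 <= m%:R :> R by rewrite natr1 ler_nat.
    by nra.
  + have : j%:R + 1 <= n%:R :> R by rewrite natr1 ler_nat.
    by nra.
- by rewrite segment_path0 segment_path1; split; [left; exists i|right; exists j].
Qed.

Lemma arc_classesE (R : realType) (m n : nat) :
  (1 <= m)%N -> (1 <= n)%N ->
  arc_classes R m n = bicoloured_class R m n @` strip_diagonal m n.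
Proof.
move=> m1 n1; apply/seteqP; split=> C.
  move=> [g [[gs [i im g0] [j jn g1]] ntg] <-].
  have gij : bicoloured_class R m n (i, j) g by split.
  exists (i, j); last by rewrite (arc_class_bicoloured gij).
  by split => // ijE; apply: ntg; apply/(trivial_bicolouredP m1 n1 gij); [left|right].
move=> [p pd <-]; have segp := segment_bicoloured R pd.
have [segs seg0 seg1] := segp; have [p1 p2 p11 pmn] := pd.
exists (segment_path (blue_point R p.1) (red_point R p.2)).
  split; last by move=> /(trivial_bicolouredP m1 n1 segp)[].
  by split; rewrite ?seg0 ?seg1; [|exists p.1|exists p.2].
exact: arc_class_bicoloured.
Qed.

Lemma bicoloured_class_inj (R : realType) (m n : nat) (p q : nat * nat) :
  strip_diagonal m n p -> bicoloured_class R m n p = bicoloured_class R m n q ->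
  p = q.
Proof.
move=> pd pq; have := segment_bicoloured R pd; rewrite pq => -[_].
rewrite segment_path0 segment_path1 => /blue_point_inj p1 /red_point_inj p2.
by rewrite [LHS]surjective_pairing p1 p2 -surjective_pairing.
Qed.

Lemma disjoint_classes_sym (R : realType) (C D : set (R -> R * R)) :
  disjoint_classes C D -> disjoint_classes D C.
Proof.
move=> [g [h [Cg Dh gh]]]; exists h, g; split => // s t s01 t01 hg.
by have [] := gh t s t01 s01 (esym hg).
Qed.

Definition comparable_pairs (p q : nat * nat) : bool :=
  (p.1 <= q.1)%N && (p.2 <= q.2)%N || (q.1 <= p.1)%N && (q.2 <= p.2)%N.

(** Parametrised by the ordinate, the difference of the abscissae of the two
    segments is an affine combination of the two nonnegative differences at
    the ends, one of which is positive. *)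
Lemma monotone_disjoint (R : realType) (m n : nat) (p q : nat * nat) :
  strip_diagonal m n p -> strip_diagonal m n q -> p <> q ->
  (p.1 <= q.1)%N -> (p.2 <= q.2)%N ->
  disjoint_classes (bicoloured_class R m n p) (bicoloured_class R m n q).
Proof.
move=> pd qd pq p1 p2.
exists (segment_path (blue_point R p.1) (red_point R p.2)).
exists (segment_path (blue_point R q.1) (red_point R q.2)).
split; [exact: segment_bicoloured|exact: segment_bicoloured|].
move=> s t; rewrite in_itv /= => /andP[s0 s1] _ [].
rewrite line_path_id /= => xE ts; rewrite -{t}ts in xE *.
suff : s = 0 \/ s = 1 by [].
have p1' : p.1%:R <= q.1%:R :> R by rewrite ler_nat.
have p2' : p.2%:R <= q.2%:R :> R by rewrite ler_nat.
have [->|s0'] := eqVneq s 0; first by left.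
have [->|s1'] := eqVneq s 1; first by right.
have {}s0 : 0 < s by rewrite lt_neqAle eq_sym s0'.
have {}s1 : s < 1 by rewrite lt_neqAle s1'.
case: pq; rewrite [LHS]surjective_pairing [RHS]surjective_pairing.
rewrite /line_path in xE.
by congr (_, _); apply/eqP; rewrite -(eqr_nat R); apply/eqP; nra.
Qed.

(** For incomparable pairs, the point where the arcs cross would be an endpoint
    of both arcs if these were disjoint, whereas these pairs have no common endpoint. *)
Lemma disjoint_classesP (R : realType) (m n : nat) (p q : nat * nat) :
  strip_diagonal m n p -> strip_diagonal m n q -> p <> q ->
  disjoint_classes (bicoloured_class R m n p) (bicoloured_class R m n q) <->
  comparable_pairs p q.
Proof.
move=> pd qd pq; split=> [|/orP[]/andP[]]; last 2 first.
- exact: monotone_disjoint.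
- move=> qp1 qp2; apply/disjoint_classes_sym/monotone_disjoint => //.
  exact/nesym.
have crossing p' q' (g h : R -> R * R) :
    bicoloured_class R m n p' g -> bicoloured_class R m n q' h ->
    (p'.1 < q'.1)%N -> (q'.2 < p'.2)%N -> ~ disjoint_arcs g h.
  move=> [[cg _ gS _ _] g0 g1] [[ch _ hS _ _] h0 h1] pq1 qp2 gh.
  have [s [t [s01 t01 gsht]]] : exists s t,
      [/\ s \in `[0, 1], t \in `[0, 1] & g s = h t].
    apply: arcs_cross => //; rewrite ?g0 ?g1 ?h0 ?h1 //= ?ltr_nat //.
    - by move=> t /gS[].
    - by move=> t /hS[].
  have [[] sE [] tE] := gh s t s01 t01 gsht; move: gsht;
    rewrite sE tE ?g0 ?g1 ?h0 ?h1.
  - by move=> /blue_point_inj; lia.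
  - exact: blue_neq_red.
  - by move=> /red_neq_blue.
  - by move=> /red_point_inj; lia.
move=> [g [h [pg qh gh]]]; apply: contrapT; rewrite /comparable_pairs => ncmp.
have [pq1|qp1] := ltnP p.1 q.1.
  by apply: (crossing _ _ _ _ pg qh) => //; lia.
have [qp1'|pq1] := ltnP q.1 p.1; last by apply: ncmp; lia.
have hg : disjoint_arcs h g.
  by move=> s t s01 t01 hg; have [] := gh t s t01 s01 (esym hg).
by apply: (crossing _ _ _ _ qh pg) => //; lia.
Qed.

(** * Dismantling the poset of diagonals *)

Lemma finite_strip_diagonal (m n : nat) : finite_set (strip_diagonal m n).
Proof.
apply: (@sub_finite_set _ _ (`I_m.+1 `*` `I_n.+1)).
  by move=> p [p1 p2 _ _]; split => /=; lia.
by apply: finite_setX; exact: finite_II.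
Qed.

Definition diagonal_complex (R : realType) (m n : nat) (G : set (nat * nat)) :=
  clique_complex (@disjoint_classes R) (bicoloured_class R m n @` G).
Arguments diagonal_complex : clear implicits.

Lemma dominated_diagonal_collapse (R : realType) (m n : nat)
    (G : set (nat * nat)) (p q : nat * nat) :
  G `<=` strip_diagonal m n -> G p -> G q -> q <> p -> comparable_pairs p q ->
  (forall u, G u -> u <> p -> comparable_pairs p u -> comparable_pairs q u) ->
  strong_collapse (diagonal_complex R m n G) (diagonal_complex R m n (G `\ p)).
Proof.
move=> GD Gp Gq qp pq dom.
have inj u v : G u -> bicoloured_class R m n u = bicoloured_class R m n v -> u = v.
  by move=> /GD; exact: bicoloured_class_inj.
have -> : diagonal_complex R m n (G `\ p) = clique_complex (@disjoint_classes R)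
    (bicoloured_class R m n @` G `\ bicoloured_class R m n p).
  congr clique_complex; apply/seteqP; split=> C.
    by move=> [u [Gu up] <-]; split; [exists u|move=> /(inj _ _ Gu)].
  by move=> [[u Gu <-] up]; exists u => //; split => // pu; apply: up; rewrite pu.
apply: (@dominated_strong_collapse _ _ _ _ (bicoloured_class R m n q)).
- exact: disjoint_classes_sym.
- by exists p.
- by exists q.
- by move=> /(inj _ _ Gq).
- by apply/(disjoint_classesP R (GD _ Gp) (GD _ Gq)) => //; exact/nesym.
move=> _ [u Gu <-] uq.
have {}uq : q <> u by move=> qu; apply: uq; rewrite qu.
have [->|/eqP up] := eqVneq u p.
  move=> _; apply/disjoint_classes_sym.
  by apply/(disjoint_classesP R (GD _ Gp) (GD _ Gq)) => //; exact/nesym.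
move/(disjoint_classesP R (GD _ Gp) (GD _ Gu)) => /(_ (nesym up)) pu.
by apply/(disjoint_classesP R (GD _ Gq) (GD _ Gu)) => //; exact: dom.
Qed.

Lemma cone_diagonal_collapse (R : realType) (m n : nat)
    (G : set (nat * nat)) (a : nat * nat) :
  G `<=` strip_diagonal m n -> G a -> (forall u, G u -> comparable_pairs a u) ->
  clos_refl_trans _ (@strong_collapse _) (diagonal_complex R m n G)
    [set [set bicoloured_class R m n a]].
Proof.
move=> GD Ga ac; apply: cone_collapse.
- exact: disjoint_classes_sym.
- by apply: finite_image; exact: sub_finite_set GD (finite_strip_diagonal m n).
- by exists a.
move=> _ [u Gu <-] ua; apply/disjoint_classesP; [exact: GD|exact: GD| |exact: ac].
by move=> au; apply: ua; rewrite au.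
Qed.

Lemma pair_neq (a b c d : nat) : a <> c \/ b <> d -> (a, b) <> (c, d).
Proof. by move=> abcd [ac bd]; case: abcd. Qed.

Definition truncated_first_row (m n k : nat) : set (nat * nat) :=
  [set p | strip_diagonal m n p /\ ((2 <= p.1)%N \/ (p.2 <= k)%N)].

(** In the first row cut after [(1, k)], the point [(1, k)] is dominated by
    [(1, k - 1)]: a pair comparable with [(1, k)] is in the first row or above
    [(1, k)].  When only [(1, 2)] remains, all its neighbours are above it in
    later rows, hence above [(2, 2)]. *)
Lemma first_row_collapse (R : realType) (m n k : nat) :
  (2 <= m)%N -> (5 <= m + n)%N -> (k < n)%N ->
  clos_refl_trans _ (@strong_collapse _)
    (diagonal_complex R m n (truncated_first_row m n k.+1))
    (diagonal_complex R m n (truncated_first_row m n 1)).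
Proof.
move=> m2 mn; elim: k => [|k IHk] kn; first exact: rt_refl.
apply: rt_trans (IHk (ltnW kn)); apply: rt_step.
have -> : truncated_first_row m n k.+1 =
    truncated_first_row m n k.+2 `\ (1%N, k.+2).
  apply/seteqP; split=> -[i j].
    move=> [ijd /= ij]; split; first by split => //=; lia.
    by move=> /= [i1 jk]; lia.
  move=> [[ijd /= ij] nij]; split => //=.
  have [j2|] := eqVneq j k.+2; last by lia.
  case: ijd => /= i1 _ _ _.
  have [i1'|] := eqVneq i 1%N; last by lia.
  by case: nij; rewrite /= i1' j2.
pose q := if k is 0 then (2%N, 2%N) else (1%N, k.+1).
apply: (@dominated_diagonal_collapse _ _ _ _ _ q).
- by move=> p [].
- by split=> /=; [split; rewrite /=; try apply: pair_neq; lia|lia].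
- by rewrite /q {q}; case: k {IHk} kn => [|k] /= kn; split=> /=;
    [split; rewrite /=; try apply: pair_neq; lia|lia|
     split; rewrite /=; try apply: pair_neq; lia|lia].
- by rewrite /q; case: (k) => [|k'] [] //; lia.
- by rewrite /q /comparable_pairs; case: (k) => [|k'] /=; lia.
move=> [i j] [[/= i1 j1 ij1 _] ij] ijp.
have i1p : i = 1%N -> j <> 1%N by move=> iE jE; apply: ij1; rewrite iE jE.
have {}ijp : i = 1%N -> j <> k.+2 by move=> iE jE; apply: ijp; rewrite iE jE.
by rewrite /q /comparable_pairs; case: (k) ij ijp => [|k'] /= ij ijp; lia.
Qed.

Theorem theorem4 (R : realType) (m n : nat)
    (hm : (1 <= m)%N) (hn : (1 <= n)%N) (hmn : (5 <= m + n)%N) :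
  strongly_collapsible (arc_complex R m n).
Proof.
have -> : arc_complex R m n = diagonal_complex R m n (strip_diagonal m n).
  by rewrite /diagonal_complex -arc_classesE.
split; first exact: clique_complex_simplicial.
  by apply: clique_complex_finite; apply: finite_image; exact: finite_strip_diagonal.
have [m1|m2] := leqP m 1.
  exists (bicoloured_class R m n (1%N, 2%N)); apply: cone_diagonal_collapse => //.
    by split; rewrite /=; try apply: pair_neq; lia.
  by move=> [i j] []; rewrite /comparable_pairs /=; lia.
exists (bicoloured_class R m n (2%N, 1%N)).
have [n1|n2] := leqP n 1.
  apply: cone_diagonal_collapse => //.
    by split; rewrite /=; try apply: pair_neq; lia.
  by move=> [i j] []; rewrite /comparable_pairs /=; lia.
have -> : strip_diagonal m n = truncated_first_row m n n.-1.+1.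
  apply/seteqP; split=> p; last by case.
  by move=> pd; split => //; case: pd => _ p2 _ _; lia.
apply: rt_trans; first by apply: (first_row_collapse R m2 hmn); lia.
apply: cone_diagonal_collapse; first by move=> p [].
  by split=> /=; [split; rewrite /=; try apply: pair_neq; lia|lia].
move=> [i j] [[/= i1 j1 ij _] ij1]; rewrite /comparable_pairs /=.
have : i = 1%N -> j <> 1%N by move=> iE jE; apply: ij; rewrite iE jE.
by lia.
Qed.
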